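(* Let $a,b$ be positive integers and let $h_j=h^{a,b}_j$ denote the number of tilings of the honeycomb strip $H_j$ by monomers of $a$ colors and dimers of $b$ colors, with $h_0=1$ and $h_j=0$ for $j<0$. Then for every integer $n\ge 1$, $$h_n-a^n=b\,h_{n-2}+2b\sum_{k=3}^{n}a^{k-2}h_{n-k}+b^2\sum_{k=3}^{n}a^{k-3}h_{n-k-1}.$$
   Context: The honeycomb strip $H_n$ consists of $n$ regular hexagons arranged in two rows, numbered $1,\dots,n$ from the bottom left so that odd-numbered hexagons form the bottom row and even-numbered ones the top row; hexagon $i$ shares an edge with hexagons $i\pm1$ and $i\pm2$ (when they exist), and with no others. A monomer is a single hexagon; a dimer is a pair of edge-adjacent hexagons, i.e. either $\{i,i+1\}$ (slanted) or $\{i,i+2\}$ (horizontal). A tiling of $H_n$ is a partition of its hexagons into monomers and dimers; in a colored tiling each monomer receives one of $a$ colors and each dimer one of $b$ colors. *)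

(* Defs.v *)
From mathcomp Require Import all_boot all_order all_algebra.
Set Implicit Arguments.
Unset Strict Implicit.
Unset Printing Implicit Defensive.
Import GRing.Theory.
Local Open Scope ring_scope.

(* The hexagons of the strip H_n are the elements of 'I_n; the ordinal i stands
   for the hexagon numbered i + 1. *)

Definition hex_adj (n : nat) : rel 'I_n := fun i j =>
  [|| (j == i + 1 :> nat)%N, (j == i + 2 :> nat)%N,
      (i == j + 1 :> nat)%N | (i == j + 2 :> nat)%N].

Definition is_monomer (n : nat) (B : {set 'I_n}) : bool :=
  [exists i, B == [set i]].

Definition is_dimer (n : nat) (B : {set 'I_n}) : bool :=
  [exists i, exists j, hex_adj i j && (B == [set i; j])].

Definition is_tiling (n : nat) (P : {set {set 'I_n}}) : bool :=
  partition P [set: 'I_n] && [forall B in P, is_monomer B || is_dimer B].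

(* A coloring of the tiling P is a finite function on all sets of hexagons,
   equal to None exactly off P, with a color [inl _] on each monomer of P and a
   color [inr _] on each dimer of P. *)
Definition is_coloring (a b n : nat) (P : {set {set 'I_n}})
    (c : {ffun {set 'I_n} -> option ('I_a + 'I_b)}) : bool :=
  [forall B : {set 'I_n},
     match c B with
     | None => B \notin P
     | Some (inl _) => (B \in P) && is_monomer B
     | Some (inr _) => (B \in P) && is_dimer B
     end].

Definition colored_tilings (a b n : nat) :
    {set {set {set 'I_n}} * {ffun {set 'I_n} -> option ('I_a + 'I_b)}} :=
  [set Pc | is_tiling Pc.1 && is_coloring Pc.1 Pc.2].

Definition h (a b : nat) (j : int) : int :=
  match j with
  | Posz n => #|colored_tilings a b n|%:Z
  | Negz _ => 0
  end.

Lemma h0 (a b : nat) : h a b 0 = 1.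
Proof.
rewrite /h; congr Posz.
have E (B : {set 'I_0}) : B = set0 by apply/setP => -[].
rewrite (_ : colored_tilings a b 0 = [set (set0, [ffun=> None])]) ?cards1 //.
apply/setP => -[P c]; rewrite !inE /=; apply/andP/eqP => [[/andP[pP _] /forallP cc]|[-> ->]].
  have P0 : P = set0.
    apply/setP => B; rewrite inE (E B).
    by case/and3P: pP => _ _ /negbTE.
  rewrite P0 in cc *; congr pair; apply/ffunP => B; rewrite ffunE.
  by move: (cc B); case: (c B) => [[]|//] x; rewrite inE.
split; last by apply/forallP => B; rewrite ffunE inE.
apply/andP; split; last by apply/forall_inP => B; rewrite inE.
by rewrite (E [set: _]) partition_set0.
Qed.

(* Main.v *)
(* Removing the last hexagon m of H_m with its tile gives
   h_m = a h_{m-1} + b h_{m-2} + a b h_{m-3} + b^2 h_{m-4}: if m is paired with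
   m-2, then hexagon m-1 can only be a monomer or be paired with m-3.  The
   right-hand side of the theorem plus a^n obeys the same recurrence.
   To count, colors are summed out first: the number of colored tilings is the
   sum over all set partitions of the product of block weights (0 for blocks
   which are no tiles).  Partitions of arbitrary subsets of a fixed 'I_n are
   allowed, so that removing tiles never changes the ambient type. *)
Require Import Defs.
From mathcomp Require Import all_boot all_order all_algebra.
From mathcomp Require Import zify ring.
Import GRing.Theory.

(** * Weighted set partitions *)

Definition partition_weight {T : finType} (w : {set T} -> nat) (S : {set T}) :=
  \sum_(P : {set {set T}} | partition P S) \prod_(B in P) w B.

Lemma partition_weight_set0 (T : finType) (w : {set T} -> nat) :
  partition_weight w set0 = 1.
Proof.
rewrite /partition_weight (big_pred1 set0) ?big_set0 // => P.
exact: partition_set0.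
Qed.

(** Group the partitions of [S] by their block [B] through [x]; deleting [B] leaves an arbitrary
    partition of [S :\: B] and drops the factor [w B]. *)
Lemma partition_weight_pblock (T : finType) (w : {set T} -> nat)
    (S : {set T}) (x : T) : x \in S ->
  partition_weight w S =
    \sum_(B : {set T} | (x \in B) && (B \subset S))
       w B * partition_weight w (S :\: B).
Proof.
move=> xS; rewrite /partition_weight.
rewrite (partition_big (fun P => pblock P x)
           (fun B => (x \in B) && (B \subset S))) => [|P /and3P[/eqP cP _ _]].
  apply: eq_bigr => B /andP[xB BS]; rewrite big_distrr /=.
  rewrite (reindex_onto (fun Q => B |: Q) (fun P => P :\ B)) /=; last first.
    move=> P /andP[/and3P[/eqP cP _ _] /eqP <-].
    by rewrite setD1K // pblock_mem // cP.
  have nB0 : B != set0 by apply/set0Pn; exists x.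
  have dB : [disjoint B & S :\: B].
    rewrite disjoint_sym disjoint_subset.
    by apply/subsetP => y; rewrite !inE => /andP[].
  apply: eq_big => [Q|Q].
    apply/andP/idP => [[/andP[pQ _] /eqP QB]|pQ].
      by rewrite -QB partitionD1 // setU11.
    have BQ : B \notin Q.
      apply/negP => BQ; have /and3P[/eqP cQ _ _] := pQ.
      have : x \in cover Q by apply/bigcupP; exists B.
      by rewrite cQ inE xB.
    have pBQ : partition (B |: Q) S.
      by have := partitionU1 pQ nB0 dB; rewrite -{2}(setIidPr BS) setID.
    rewrite pBQ setU1K // eqxx; split=> //=; apply/eqP/def_pblock => //.
      by case/and3P: pBQ.
    exact: setU11.
  case/andP=> _ /eqP QB; rewrite big_setU1 //= -QB.
  by rewrite !inE eqxx.
have xP : x \in cover P by rewrite cP.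
by rewrite mem_pblock xP /= -cP (bigcup_max (pblock P x)) ?pblock_mem.
Qed.

(** * Colored tilings as weighted partitions *)

Definition tile_weight (a b : nat) {n : nat} (B : {set 'I_n}) : nat :=
  is_monomer B * a + is_dimer B * b.

(** The values of a coloring at different sets are chosen independently, so the count is a product
    over all sets; a set off [P] admits only [None] and contributes 1. *)
Lemma card_coloring (a b n : nat) (P : {set {set 'I_n}}) :
  #|[set c | @is_coloring a b n P c]| = \prod_(B in P) tile_weight a b B.
Proof.
pose F (B : {set 'I_n}) (o : option ('I_a + 'I_b)) :=
  match o with
  | None => B \notin P
  | Some (inl _) => (B \in P) && is_monomer B
  | Some (inr _) => (B \in P) && is_dimer B
  end.
transitivity #|family F|.
  apply: eq_card => c; rewrite inE; apply/forallP/familyP => cF B; exact: cF.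
rewrite card_family foldrE big_image /= [RHS]big_mkcond /=.
apply: eq_bigr => B _.
case: ifPn => BP; last first.
  rewrite -(card1 (@None ('I_a + 'I_b))); apply: eq_card => o.
  by rewrite [LHS]unfold_in /F (negbTE BP); case: o => [[]|].
pose G (s : 'I_a + 'I_b) := if s is inl _ then is_monomer B else is_dimer B.
transitivity #|[seq Some s | s in G]|.
  apply: eq_card => -[s|]; rewrite [LHS]unfold_in /F ?BP.
    by rewrite mem_map ?mem_enum => [|? ? []] //; case: s.
  by apply/esym/negbTE/mapP => -[].
rewrite card_image; last by move=> ? ? [].
rewrite -sum1_card big_mkcond /= big_sumType /= !sum_nat_const !card_ord.
by rewrite /in_mem /= /G /tile_weight; case: is_monomer; case: is_dimer; lia.
Qed.

Lemma card_colored_tilings (a b n : nat) :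
  #|colored_tilings a b n| = partition_weight (tile_weight a b) [set: 'I_n].
Proof.
rewrite -sum1_card (eq_bigl (fun Pc =>
  is_tiling Pc.1 && is_coloring Pc.1 Pc.2)); last by move=> Pc; rewrite inE.
rewrite -(pair_big_dep (@is_tiling n) (@is_coloring a b n) (fun _ _ => 1)) /=.
rewrite /partition_weight /is_tiling [RHS](bigID (fun P : {set {set 'I_n}} =>
  [forall B in P, is_monomer B || is_dimer B])) /=.
(* A partition with a block that is no tile has a zero factor. *)
rewrite [X in _ + X]big1 ?addn0 => [|P /andP[_ /forall_inPn[B PB]]].
  apply: eq_bigr => P _; rewrite -card_coloring -sum1_card.
  by apply: eq_bigl => c; rewrite inE.
rewrite (bigD1 B) //= negb_or => /andP[/negbTE m /negbTE d].
by rewrite /tile_weight m d.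
Qed.

Lemma partition_weight_hex (a b n : nat) (S : {set 'I_n}) (x : 'I_n) : x \in S ->
  partition_weight (tile_weight a b) S =
    a * partition_weight (tile_weight a b) (S :\ x) +
    b * \sum_(j in S | hex_adj x j)
          partition_weight (tile_weight a b) (S :\ x :\ j).
Proof.
set Z := partition_weight _ => xS.
rewrite [LHS](partition_weight_pblock _ _ _ _ xS) -/Z.
have adjx i j : hex_adj i j -> i != j :> 'I_n.
  rewrite /hex_adj; apply: contraTneq => ->; lia.
rewrite (eq_bigr (fun B => is_monomer B * a * Z (S :\: B) +
  is_dimer B * b * Z (S :\: B))); last by move=> B _; rewrite mulnDl.
rewrite big_split /=; congr addn.
  rewrite (bigD1 [set x]) /= ?set11 ?sub1set // big1 ?addn0.
    suff -> : is_monomer [set x] by rewrite mul1n.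
    by apply/existsP; exists x.
  move=> B /andP[/andP[xB _] Bx].
  suff /negbTE -> : ~~ is_monomer B by [].
  apply: contra Bx => /existsP[i /eqP Bi].
  by move: xB; rewrite Bi inE => /eqP ->.
(* The dimers through [x] inside [S] are the images of [A] under [j |-> [set x; j]], which is
   injective on [A] because neighbors of [x] differ from [x]. *)
pose A := [set j in S | hex_adj x j].
rewrite (bigID (fun B => B \in [set [set x; j] | j in A])) /=.
rewrite [X in _ + X]big1 ?addn0; last first.
  move=> B /andP[/andP[xB BS] BA]; suff /negbTE -> : ~~ is_dimer B by [].
  apply: contra BA => /existsP[i /existsP[j /andP[aij /eqP Bij]]].
  move: xB BS; rewrite Bij !inE subUset !sub1set => /orP[] /eqP xE /andP[iS jS].
    by apply/imsetP; exists j; rewrite ?inE ?jS ?xE.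
  apply/imsetP; exists i; rewrite ?inE ?iS ?xE 1?setUC //=.
  by move: aij; rewrite /hex_adj; lia.
rewrite (eq_bigl (mem [set [set x; j] | j in A])); last first.
  move=> B; apply: andb_idl => /imsetP[j]; rewrite inE => /andP[jS _] ->.
  by rewrite set21 subUset !sub1set xS.
rewrite big_imset /=; last first.
  move=> i j; rewrite !inE => /andP[_ /adjx xi] /andP[_ /adjx xj] /setP/(_ i).
  by rewrite !inE eqxx orbT eq_sym (negbTE xi) /= => /esym/eqP.
rewrite big_distrr /=; apply: eq_big => [j|j]; first by rewrite inE.
rewrite inE => /andP[_ aj]; rewrite setDDl.
suff -> : is_dimer [set x; j] by rewrite mul1n.
by apply/existsP; exists x; apply/existsP; exists j; rewrite aj eqxx.
Qed.

(** * Recurrence for initial segments of the strip *)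

(** A predicate on [nat] describes the region, so that equality of regions is plain arithmetic. *)
Definition strip_weight (a b n : nat) (p : pred nat) : nat :=
  partition_weight (tile_weight a b) [set i : 'I_n | p i].

Lemma eq_strip_weight (a b n : nat) (p q : pred nat) :
  p =1 q -> strip_weight a b n p = strip_weight a b n q.
Proof. by move=> pq; congr partition_weight; apply/setP => i; rewrite !inE. Qed.

(** At most one [j] satisfies [x = j + d]; the guard [d <= x] excludes truncated subtraction. *)
Lemma big_ord_offset (n x d : nat) (p : pred nat) (G : nat -> nat) : x < n ->
  \sum_(j < n | p j && (x == j + d)) G j =
    ((d <= x) && p (x - d)) * G (x - d).
Proof.
move=> xn; case: (boolP ((d <= x) && p (x - d))) => [/andP[dx px]|npx].
  have jn : x - d < n by lia.
  rewrite (big_pred1 (Ordinal jn)) ?mul1n // => j /=.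
  apply/andP/eqP => [[_ /eqP xj]|->]; first by apply: val_inj => /=; lia.
  by rewrite px subnK.
rewrite big_pred0 // => j; apply/negP => /andP[pj /eqP xj].
by case/negP: npx; rewrite xj leq_addl addnK.
Qed.

(** The largest hexagon [x] of a region can only be paired downwards, with [x - 1] or [x - 2]. *)
Lemma strip_weight_max (a b n x : nat) (p : pred nat) :
    x < n -> p x -> (forall i, p i -> i <= x) ->
  strip_weight a b n p =
    a * strip_weight a b n [pred i | p i && (i != x)] +
    b * (((0 < x) && p (x - 1)) *
           strip_weight a b n [pred i | [&& p i, i != x & i != x - 1]] +
         ((1 < x) && p (x - 2)) *
           strip_weight a b n [pred i | [&& p i, i != x & i != x - 2]]).
Proof.
move=> xn px pmax; rewrite /strip_weight.
rewrite (partition_weight_hex _ _ _ _ (Ordinal xn)) ?inE //; congr (_ * _ + _ * _).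
  by congr partition_weight; apply/setP => i; rewrite !inE andbC -val_eqE.
pose G j := strip_weight a b n [pred i | [&& p i, i != x & i != j]].
rewrite -(big_ord_offset n x 1 p G) // -(big_ord_offset n x 2 p G) //.
rewrite (bigID (fun j : 'I_n => x == j + 1)) /=.
have GE j : partition_weight (tile_weight a b)
    ([set i : 'I_n | p i] :\ Ordinal xn :\ j) = G j.
  congr partition_weight; apply/setP => i; rewrite !inE -!val_eqE /=.
  by case: (p i); rewrite ?andbF //= andbT andbC.
congr addn; apply: eq_big => // j; rewrite inE /hex_adj /=;
  by have := pmax j; case: (p j) => //= /(_ isT); lia.
Qed.

Lemma strip_weight_initial_rec (a b n x : nat) : x < n ->
  strip_weight a b n (gtn x.+1) =
    a * strip_weight a b n (gtn x) +
    (0 < x) * (b * strip_weight a b n (gtn x.-1)) +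
    (1 < x) * (a * b * strip_weight a b n (gtn x.-2)) +
    (2 < x) * (b ^ 2 * strip_weight a b n (gtn (x - 3))).
Proof.
move=> xn; rewrite (strip_weight_max _ _ _ x) //=; try by move=> *; lia.
rewrite (eq_strip_weight _ _ _ _ (gtn x)); last by move=> i /=; lia.
rewrite (eq_strip_weight _ _ _ [pred i | [&& _, _ & i != x - 1]] (gtn x.-1));
  last by move=> i; rewrite /=; lia.
have -> : (0 < x) && (x - 1 < x.+1) = (0 < x) by lia.
have -> : (1 < x) && (x - 2 < x.+1) = (1 < x) by lia.
case: (ltnP 1 x) => x1; last first.
  have -> : 2 < x = false by lia.
  by case: (0 < x); lia.
(* [q] is the region left by the dimer [{x - 2, x}]: all [i < x - 2] together with [x - 1].
   Expanding at [x - 1], whose only possible partner in [q] is [x - 3], yields the last two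
   terms. *)
set q := [pred i | _]; have qmax i : q i -> i <= x - 1 by rewrite /q /=; lia.
rewrite (strip_weight_max _ _ _ (x - 1) q) //; try by rewrite /q /=; lia.
rewrite (eq_strip_weight _ _ _ [pred i | q i && (i != x - 1)] (gtn x.-2));
  last by move=> i; rewrite /q /=; lia.
rewrite (eq_strip_weight _ _ _ [pred i | [&& _, _ & i != x - 1 - 2]]
  (gtn (x - 3))); last by move=> i; rewrite /q /=; lia.
have -> : (0 < x - 1) && q (x - 1 - 1) = false by rewrite /q /=; lia.
have -> : (1 < x - 1) && q (x - 1 - 2) = (2 < x) by rewrite /q /=; lia.
have -> : 0 < x by lia.
by rewrite mul0n add0n !mul1n; case: (2 < x); rewrite ?mul1n ?mul0n; ring.
Qed.

(** In both ambient types the weights obey the same recurrence and equal 1 on the empty region. This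
    turns weights inside one fixed ['I_n] into tiling counts of shorter strips. *)
Lemma strip_weight_ambient (a b m n : nat) : m <= n ->
  strip_weight a b n (gtn m) = #|colored_tilings a b m|.
Proof.
move=> mn; transitivity (strip_weight a b m (gtn m)); last first.
  rewrite card_colored_tilings; congr partition_weight.
  by apply/setP => i; rewrite !inE ltn_ord.
suff E k : k <= m -> strip_weight a b n (gtn k) = strip_weight a b m (gtn k).
  exact: E.
elim/ltn_ind: k => -[_ _|x IH xm].
  have W0 l : strip_weight a b l (gtn 0) = 1.
    rewrite /strip_weight -[RHS](partition_weight_set0 _ (@tile_weight a b l)).
    by congr partition_weight; apply/setP => i; rewrite !inE.
  by rewrite !W0.
rewrite !strip_weight_initial_rec //; last exact: leq_trans xm mn.
by rewrite !IH //; lia.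
Qed.

(** * Integer recurrence and summation formula *)

Local Open Scope ring_scope.

Lemma h_rec (a b n : nat) :
  h a b n.+1%:Z = a%:Z * h a b n%:Z + b%:Z * h a b (n%:Z - 1)
    + a%:Z * b%:Z * h a b (n%:Z - 2) + b%:Z ^+ 2 * h a b (n%:Z - 3).
Proof.
rewrite {1 2}/h -(strip_weight_ambient a b _ _ (leqnn n.+1)).
rewrite strip_weight_initial_rec // !strip_weight_ambient //; try lia.
have hneg k : (n < k)%N -> h a b (n%:Z - k%:Z) = 0.
  by move=> nk; have -> : n%:Z - k%:Z = Negz (k - n).-1 by lia.
have hpos k : (k <= n)%N ->
    h a b (n%:Z - k%:Z) = #|colored_tilings a b (n - k)|.
  by move=> kn; have -> : n%:Z - k%:Z = (n - k)%N by lia.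
(* The cases [n = 0, 1, 2] and [n >= 3] differ in which indices are negative; there the vanishing
   guards match the zero values of [h]. *)
case: n hneg hpos => [|[|[|n]]] hneg hpos.
- by rewrite !hneg //= !mul0n !addn0 PoszM; ring.
- by rewrite (hpos 1) // !hneg //= !mul0n !addn0 mul1n PoszD !PoszM; ring.
- rewrite (hpos 1) // (hpos 2) // !hneg //= mul0n addn0 !mul1n.
  by rewrite !PoszD !PoszM; ring.
- by rewrite !hpos //= !subSS !subn0 !mul1n -mulnn !PoszD !PoszM; ring.
Qed.

Theorem theorem6 (a b : nat) (ha : (0 < a)%N) (hb : (0 < b)%N)
    (n : nat) (hn : (1 <= n)%N) :
  h a b n%:Z - a%:Z ^+ n =
    b%:Z * h a b (n%:Z - 2)
    + 2 * b%:Z * \sum_(3 <= k < n.+1) a%:Z ^+ (k - 2)%N * h a b (n%:Z - k%:Z)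
    + b%:Z ^+ 2 * \sum_(3 <= k < n.+1) a%:Z ^+ (k - 3)%N * h a b (n%:Z - k%:Z - 1).
Proof.
have hneg k : h a b (Negz k) = 0 by [].
have h1 : h a b 1 = a%:Z.
  by rewrite (h_rec a b 0) !sub0r !hneg h0; ring.
(* For lengths 1 and 2 both sums are empty. The inductive step goes from [n.+2] to [n.+3], where a
   term [k = 3] can be split off. *)
case: n hn => // n _; elim: n => [|[|n] IH].
- by rewrite !big_geq // h1 hneg; ring.
- by rewrite !big_geq // (h_rec a b 1) h1 !hneg !h0; ring.
have shift (F : nat -> int) :
    \sum_(3 <= k < n.+4) F k = F 3 + \sum_(3 <= k < n.+3) F k.+1.
  by rewrite big_nat_recl.
rewrite !shift h_rec.
have -> : h a b n.+2 = a%:Z ^+ n.+2 + (h a b n.+2 - a%:Z ^+ n.+2) by ring.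
rewrite IH.
set s1 := \sum_(3 <= k < n.+3) _; set s2 := \sum_(3 <= k < n.+3) _.
(* Without their [k = 3] terms, the sums for [n.+3] are [a] times those for [n.+2]. *)
have -> : \sum_(3 <= k < n.+3)
    a%:Z ^+ (k.+1 - 2)%N * h a b (n.+3%:Z - k.+1%:Z) = a%:Z * s1.
  rewrite mulr_sumr; apply: eq_big_nat => k /andP[k3 _].
  rewrite mulrA -exprS; congr (_ ^+ _ * h a b _); lia.
have -> : \sum_(3 <= k < n.+3)
    a%:Z ^+ (k.+1 - 3)%N * h a b (n.+3%:Z - k.+1%:Z - 1) = a%:Z * s2.
  rewrite mulr_sumr; apply: eq_big_nat => k /andP[k3 _].
  rewrite mulrA -exprS; congr (_ ^+ _ * h a b _); lia.
have -> : n.+3%:Z - 2 = n.+2%:Z - 1 by lia.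
have -> : n.+3%:Z - 3%N%:Z = n.+2%:Z - 2 by lia.
have -> : n.+2%:Z - 2 - 1 = n.+2%:Z - 3 by lia.
(* The coefficient [2 * b * a] of [h_n] at [k = 3] arises once from the recurrence and once from [a]
   times the term [b * h_n] of the induction hypothesis. *)
by rewrite !exprS; ring.
Qed.
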